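(* Every ring $A$ satisfying the following three conditions is $2$-Jacobson: (1) $A$ is integral, i.e., every element of $A$ is zero or regular; (2) the Krull dimension of $A$ is less than $2$; (3) for any regular element $x\in A$, there exists $a\in A$ such that if $1-ax$ is a unit of $A$, then $1=0$ in $A$. In particular, $\mathbb{Z}$ is $2$-Jacobson, and $K[X]$ is $2$-Jacobson for every discrete field $K$.
   Context: All rings are commutative with identity (the trivial ring is allowed). A regular element is a non-zero-divisor ($xy=0$ implies $y=0$). A ring $K$ is called a discrete field if every element of $K$ is zero or invertible. For a subset $U$ of a ring $A$, $\langle U\rangle$ denotes the ideal generated by $U$. $\mathrm{Nil}_A 0:=\{x\in A:\exists n\ge 0,\ x^n=0\}$ is the nilradical. The image of an element in a quotient ring is denoted by the same letter. For a ring $A$, elements $x,x'\in A$ and an ordinal $\alpha$, the property ''the triple $(A,x,x')$ is $\alpha$-Jacobson'' is defined by recursion on $\alpha$: (1) $(A,x,x')$ is $0$-Jacobson if $x'\in\mathrm{Nil}_A 0$. (2) For $\alpha>0$, $(A,x,x')$ is $\alpha$-Jacobson if there exist $n\ge 0$ and $a_1,\ldots,a_n\in A$ such that for any $b_1,\ldots,b_n\in A$ there exists an ordinal $\beta<\alpha$ such that $(A/\langle 1-b_i(1-a_ix): i\in\{1,\ldots,n\}\rangle,\,x,\,x')$ is $\beta$-Jacobson. A ring $A$ is called $\alpha$-Jacobson if $(A,x,x)$ is $\alpha$-Jacobson for all $x\in A$. *)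

(* Defs.v *)
From HB Require Import structures.
From mathcomp Require Import all_boot all_order all_algebra.
From mathcomp Require Import boolp classical_sets functions.

(* Rings are [comPzRingType]s: commutative with identity, possibly trivial.
   The library puts a ring structure on quotients and on polynomials only in the
   nontrivial case, so both are provided here for [comPzRingType]. *)

Set Implicit Arguments.
Unset Strict Implicit.
Unset Printing Implicit Defensive.

Import Order.TTheory GRing.Theory.
Local Open Scope ring_scope.
Local Open Scope classical_set_scope.
Local Open Scope quotient_scope.

Definition invertible (A : comPzRingType) (x : A) : Prop :=
  exists y, x * y = 1.

Definition regular (A : comPzRingType) (x : A) : Prop :=
  forall y, x * y = 0 -> y = 0.

Definition integral (A : comPzRingType) : Prop :=
  forall x : A, x = 0 \/ regular x.

Definition discrete_field (K : comPzRingType) : Prop :=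
  forall x : K, x = 0 \/ invertible x.

Definition nilradical (A : comPzRingType) : set A :=
  [set x | exists n : nat, x ^+ n = 0].

Definition is_ideal (A : comPzRingType) (I : set A) : Prop :=
  [/\ I 0, forall x y, I x -> I y -> I (x + y) & forall a x, I x -> I (a * x)].

Definition prime_ideal (A : comPzRingType) (P : set A) : Prop :=
  [/\ is_ideal P, ~ P 1 & forall x y, P (x * y) -> P x \/ P y].

(* The Krull dimension is the supremum of the [n] for which there is a chain
   P_0 < ... < P_n of prime ideals; the trivial ring has dimension less than 0. *)
Definition krull_dim_lt (A : comPzRingType) (n : nat) : Prop :=
  ~ exists P : 'I_n.+1 -> set A,
      (forall i, prime_ideal (P i)) /\
      (forall i j : 'I_n.+1, (i < j)%N -> P i `<` P j).

Section IdealGenerated.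
Variables (A : comPzRingType) (U : set A).

Definition ideal_gen : {pred A} := fun z =>
  `[< exists (n : nat) (c u : 'I_n -> A),
        (forall i, U (u i)) /\ z = \sum_(i < n) c i * u i >].

Lemma ideal_gen_ideal : is_ideal [set z | z \in ideal_gen].
Proof.
split=> /=.
- by apply/asboolP; exists 0%N, (fun=> 0), (fun=> 0); split; [case|rewrite big_ord0].
- move=> x y /asboolP[n [c [u [Uu ->]]]] /asboolP[m [e [v [Uv ->]]]].
  apply/asboolP; exists (n + m)%N.
  exists (fun i => match fintype.split i with inl j => c j | inr j => e j end).
  exists (fun i => match fintype.split i with inl j => u j | inr j => v j end).
  split=> [i|]; first by case: (fintype.split i).
  rewrite big_split_ord /=; congr (_ + _); apply: eq_bigr => i _.
    by rewrite (unsplitK (inl i)).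
  by rewrite (unsplitK (inr i)).
- move=> a x /asboolP[n [c [u [Uu ->]]]]; apply/asboolP.
  exists n, (fun i => a * c i), u; split=> //.
  by rewrite mulr_sumr; apply: eq_bigr => i _; rewrite mulrA.
Qed.

Lemma ideal_genM a x : x \in ideal_gen -> a * x \in ideal_gen.
Proof. by case: ideal_gen_ideal => _ _; apply. Qed.

Lemma ideal_gen_zmod_closed : zmod_closed ideal_gen.
Proof.
case: ideal_gen_ideal => I0 ID IM; split=> // x y Ix Iy.
by apply: ID => //; rewrite -mulN1r; apply: IM.
Qed.

HB.instance Definition _ :=
  GRing.isZmodClosed.Build A ideal_gen ideal_gen_zmod_closed.

Lemma mem_ideal_gen x : U x -> x \in ideal_gen.
Proof.
move=> Ux; apply/asboolP; exists 1%N, (fun=> 1), (fun=> x).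
by split=> //; rewrite big_ord1 mul1r.
Qed.

Lemma ideal_gen_min (I : set A) :
  is_ideal I -> U `<=` I -> [set z | z \in ideal_gen] `<=` I.
Proof.
move=> [I0 ID IM] UI z /asboolP[n [c [u [Uu ->]]]].
by elim/big_ind: _ => // i _; apply/IM/UI/Uu.
Qed.

(* A / <U> *)
Definition ringquot : Type := {ideal_quot ideal_gen}.

HB.instance Definition _ := GRing.Zmodule.on ringquot.

Definition ringquot_pi (x : A) : ringquot := \pi_({ideal_quot ideal_gen}) x.

Definition ringquot_mul (x y : ringquot) : ringquot :=
  ringquot_pi (repr (x : {ideal_quot ideal_gen}) * repr (y : {ideal_quot ideal_gen})).

Lemma ringquot_piP x y : ringquot_pi x = ringquot_pi y <-> x - y \in ideal_gen.
Proof. by rewrite Quotient.idealrBE; split=> [/eqP|/eqP]. Qed.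

Lemma ringquot_pi_surj (q : ringquot) : exists x, q = ringquot_pi x.
Proof. by exists (repr (q : {ideal_quot ideal_gen})); rewrite /ringquot_pi reprK. Qed.

Lemma ringquot_piD : zmod_morphism ringquot_pi.
Proof. exact: (raddfB (\pi_({ideal_quot ideal_gen}))). Qed.

HB.instance Definition _ :=
  GRing.isZmodMorphism.Build A ringquot ringquot_pi ringquot_piD.

Lemma ringquot_piM x y :
  ringquot_mul (ringquot_pi x) (ringquot_pi y) = ringquot_pi (x * y).
Proof.
have E z : repr (ringquot_pi z : {ideal_quot ideal_gen}) - z \in ideal_gen.
  by apply/ringquot_piP; rewrite /ringquot_pi reprK.
apply/ringquot_piP.
set x' := repr _; set y' := repr _.
rewrite (_ : _ - _ = x' * (y' - y) + y * (x' - x)); last first.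
  by rewrite !mulrBr addrA (mulrC y x') subrK (mulrC y x).
by rewrite rpredD // ideal_genM // E.
Qed.

Lemma ringquot_mulA : associative ringquot_mul.
Proof.
move=> p q r; have [[x ->] [y ->] [z ->]] :=
  And3 (ringquot_pi_surj p) (ringquot_pi_surj q) (ringquot_pi_surj r).
by rewrite !ringquot_piM mulrA.
Qed.

Lemma ringquot_mulC : commutative ringquot_mul.
Proof. by move=> p q; rewrite /ringquot_mul mulrC. Qed.

Lemma ringquot_mul1 : left_id (ringquot_pi 1) ringquot_mul.
Proof. by move=> p; have [x ->] := ringquot_pi_surj p; rewrite ringquot_piM mul1r. Qed.

Lemma ringquot_mulDl : left_distributive ringquot_mul +%R.
Proof.
move=> p q r; have [[x ->] [y ->] [z ->]] :=
  And3 (ringquot_pi_surj p) (ringquot_pi_surj q) (ringquot_pi_surj r).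
by rewrite -raddfD !ringquot_piM -raddfD mulrDl.
Qed.

HB.instance Definition _ := GRing.Zmodule_isComPzRing.Build ringquot
  ringquot_mulA ringquot_mulC ringquot_mul1 ringquot_mulDl.

Lemma ringquot_pi_monoid : monoid_morphism ringquot_pi.
Proof. by split=> // x y; rewrite -ringquot_piM. Qed.

HB.instance Definition _ :=
  GRing.isMonoidMorphism.Build A ringquot ringquot_pi ringquot_pi_monoid.

End IdealGenerated.

(* [jacobson_triple alpha x x'] : the triple (A, x, x') is alpha-Jacobson, where
   the ordinal alpha is an element of a well-ordered type [O] and stands for the
   order type of {beta | beta < alpha}. In [nat], the element n is the ordinal n.
   As < is well founded on [O], the inductive definition amounts to recursion on
   alpha. *)
Inductive jacobson_triple (d : Order.disp_t) (O : bOrderType d) (alpha : O)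
    (A : comPzRingType) (x x' : A) : Prop :=
| Jacobson0 of alpha = \bot%O & nilradical x'
| JacobsonS of (\bot < alpha)%O &
    exists (n : nat) (a : 'I_n -> A), forall b : 'I_n -> A,
      let U := range (fun i => 1 - b i * (1 - a i * x)) in
      exists2 beta : O, (beta < alpha)%O &
        jacobson_triple beta (ringquot_pi U x) (ringquot_pi U x').

Definition jacobson_ring (d : Order.disp_t) (O : bOrderType d) (alpha : O)
    (A : comPzRingType) : Prop :=
  forall x : A, jacobson_triple alpha x x.

(* Polynomials over a possibly trivial ring, as eventually zero sequences of
   coefficients. *)
Section PzPoly.
Variable K : comPzRingType.

Definition eventually0 : {pred nat -> K} := fun c =>
  `[< exists n : nat, forall i, (n <= i)%N -> c i = 0 >].

Lemma eventually0_zmod_closed : zmod_closed eventually0.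
Proof.
split=> [|c e]; first by apply/asboolP; exists 0%N.
move=> /asboolP[n cn] /asboolP[m em]; apply/asboolP; exists (maxn n m) => i.
by rewrite geq_max => /andP[/cn ci /em ei]; rewrite /= !fctE ci ei subrr.
Qed.

HB.instance Definition _ :=
  GRing.isZmodClosed.Build (nat -> K) eventually0 eventually0_zmod_closed.

Record pzpoly := PzPoly { pzcoef :> nat -> K; _ : pzcoef \in eventually0 }.

HB.instance Definition _ := [isSub for pzcoef].
HB.instance Definition _ := [Choice of pzpoly by <:].
HB.instance Definition _ := [SubChoice_isSubZmodule of pzpoly by <:].

Lemma pzpolyP (p q : pzpoly) : p =1 q -> p = q.
Proof. by move=> pq; apply/val_inj/funext. Qed.

Lemma pzcoefD (p q : pzpoly) i : (p + q) i = p i + q i.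
Proof. by []. Qed.

Lemma pzpolyC_subproof (c : K) :
  (fun i => if i == 0%N then c else 0) \in eventually0.
Proof. by apply/asboolP; exists 1%N; case. Qed.

Definition pzpolyC c := PzPoly (pzpolyC_subproof c).

Lemma pzpolyX_subproof :
  (fun i => if i == 1%N then 1 else 0 : K) \in eventually0.
Proof. by apply/asboolP; exists 2%N; case=> [|[]]. Qed.

Definition pzpolyX := PzPoly pzpolyX_subproof.

Lemma pzpoly_mul_subproof (p q : pzpoly) :
  (fun i => \sum_(j < i.+1) p j * q (i - j)%N) \in eventually0.
Proof.
case: p q => [p /asboolP[n pn]] [q /asboolP[m qm]] /=.
apply/asboolP; exists (n + m)%N => i nmi; rewrite big1 // => j _.
have [nj|jn] := leqP n j; first by rewrite pn ?mul0r.
rewrite qm ?mulr0 // leq_subRL ?(leq_trans _ nmi) ?leq_add2r //.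
  by rewrite ltnW.
by rewrite (leq_trans (ltnW jn)) ?leq_addr.
Qed.

Definition pzpoly_mul p q := PzPoly (pzpoly_mul_subproof p q).

Lemma pzpoly_mulC : commutative pzpoly_mul.
Proof.
move=> p q; apply: pzpolyP => i /=; rewrite (reindex_inj rev_ord_inj) /=.
by apply: eq_bigr => j _; rewrite (sub_ordK j) mulrC.
Qed.

Lemma pzpoly_mulA : associative pzpoly_mul.
Proof.
move=> p q r; rewrite (pzpoly_mulC q); apply: pzpolyP => i.
rewrite (pzpoly_mulC _ r) /=.
pose coef3 j k := p j * (r k * q (i - j - k)%N).
transitivity (\sum_(j < i.+1) \sum_(k < i.+1 | (k <= i - j)%N) coef3 j k).
  apply: eq_bigr => /= j _; rewrite big_distrr /=.
  by rewrite (big_ord_narrow_leq (leq_subr _ _)).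
rewrite (exchange_big_dep predT) //=; apply: eq_bigr => k _.
transitivity (\sum_(j < i.+1 | (j <= i - k)%N) coef3 j k).
  apply: eq_bigl => j; rewrite -ltnS -(ltnS j) -!subSn ?leq_ord //.
  by rewrite -subn_gt0 -(subn_gt0 j) -!subnDA addnC.
rewrite (big_ord_narrow_leq (leq_subr _ _)) big_distrr /=.
by apply: eq_bigr => j _; rewrite /coef3 -!subnDA addnC mulrCA.
Qed.

Lemma pzpoly_mul1 : left_id (pzpolyC 1) pzpoly_mul.
Proof.
move=> p; apply: pzpolyP => i /=; rewrite big_ord_recl subn0 mul1r.
by rewrite big1 ?addr0 // => j _; rewrite mul0r.
Qed.

Lemma pzpoly_mulDl : left_distributive pzpoly_mul +%R.
Proof.
move=> p q r; apply: pzpolyP => i.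
transitivity (pzpoly_mul p r i + pzpoly_mul q r i) => //=.
by rewrite -big_split /=; apply: eq_bigr => j _; rewrite -mulrDl.
Qed.

HB.instance Definition _ := GRing.Zmodule_isComPzRing.Build pzpoly
  pzpoly_mulA pzpoly_mulC pzpoly_mul1 pzpoly_mulDl.

End PzPoly.

(* Over a nontrivial ring, [pzpoly K] is the library's [{poly K}]. *)
Section PzPolyPoly.
Variable K : comNzRingType.

Lemma pzpoly_of_poly_subproof (p : {poly K}) : (fun i => p`_i) \in eventually0 (K := K).
Proof. by apply/asboolP; exists (size p) => i /leq_sizeP; apply. Qed.

Definition pzpoly_of_poly (p : {poly K}) : pzpoly K :=
  PzPoly (pzpoly_of_poly_subproof p).

Lemma pzpoly_of_poly_zmod : zmod_morphism pzpoly_of_poly.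
Proof. by move=> p q; apply: pzpolyP => i; rewrite /= coefB. Qed.

HB.instance Definition _ := GRing.isZmodMorphism.Build {poly K} (pzpoly K)
  pzpoly_of_poly pzpoly_of_poly_zmod.

Lemma pzpoly_of_poly_monoid : monoid_morphism pzpoly_of_poly.
Proof.
split=> [|p q]; apply: pzpolyP => i; last by rewrite /= coefM.
by rewrite /= coef1; case: i.
Qed.

HB.instance Definition _ := GRing.isMonoidMorphism.Build {poly K} (pzpoly K)
  pzpoly_of_poly pzpoly_of_poly_monoid.

Lemma pzpoly_of_poly_bij : bijective pzpoly_of_poly.
Proof.
pose bound (q : pzpoly K) := cid (asboolP _ (valP q)).
exists (fun q => \poly_(i < sval (bound q)) q i) => [p|q].
  apply/polyP => i; rewrite coef_poly; case: ltnP => // le_i.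
  by have /= -> := svalP (bound (pzpoly_of_poly p)) i le_i.
apply: pzpolyP => i; rewrite /= coef_poly; case: ltnP => // le_i.
by rewrite (svalP (bound q) i le_i).
Qed.

End PzPolyPoly.

(* Main.v *)
Require Import Defs.
From HB Require Import structures.
From mathcomp Require Import all_boot all_order all_algebra.
From mathcomp Require Import boolp classical_sets functions ring zify.

Set Implicit Arguments.
Unset Strict Implicit.
Unset Printing Implicit Defensive.

Import GRing.Theory.
Local Open Scope ring_scope.

(** Let [A] be nontrivial and [x] nonzero, and take [a] such that [1 - a x] is
not a unit. Then [d := 1 - b (1 - a x)] is nonzero for every [b], so [A / <d>]
has dimension less than 1, and [x ^+ n * (1 - c * x)] vanishes there for some
[n] and [c]. Indeed, otherwise some prime [P] contains [d] and avoids the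
multiplicative set of these elements; then [x] is not in [P] and [P + <x>] is
proper, so [0 < P < M] for some maximal [M]. In any quotient of [A / <d>] where
[1 - c x] is invertible, [x] is therefore nilpotent.
The rings [int] and [K[X]] are Euclidean, hence of dimension less than 2, and
condition (3) holds with [a = 3] and [a = 'X] respectively. *)

(** * Prime ideals avoiding a multiplicative set *)

Definition mult_closed (A : comPzRingType) (S : set A) : Prop :=
  S 1 /\ forall s t, S s -> S t -> S (s * t).

Definition ideal_adjoin (A : comPzRingType) (I : set A) (x : A) : set A :=
  [set z | exists p a, I p /\ z = p + a * x]%classic.

Lemma ideal_adjoin_ideal (A : comPzRingType) (I : set A) (x : A) :
  is_ideal I -> is_ideal (ideal_adjoin I x).
Proof.
move=> [I0 ID IM]; split.
- by exists 0, 0; split=> //; rewrite mul0r addr0.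
- move=> _ _ [p [a [Ip ->]]] [q [b [Iq ->]]]; exists (p + q), (a + b).
  by split; [exact: ID | rewrite mulrDl addrACA].
- move=> b _ [p [a [Ip ->]]]; exists (b * p), (b * a).
  by split; [exact: IM | rewrite mulrDr mulrA].
Qed.

Lemma sub_ideal_adjoin (A : comPzRingType) (I : set A) (x : A) :
  (I `<=` ideal_adjoin I x)%classic.
Proof. by move=> p Ip; exists p, 0; rewrite mul0r addr0. Qed.

Lemma mem_ideal_adjoin (A : comPzRingType) (I : set A) (x : A) :
  is_ideal I -> ideal_adjoin I x x.
Proof. by move=> [I0 _ _]; exists 0, 1; rewrite mul1r add0r. Qed.

Lemma zero_ideal (A : comPzRingType) : is_ideal [set (0 : A)]%classic.
Proof.
by split=> [//|x y -> ->|a x ->]; rewrite /= ?addr0 ?mulr0.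
Qed.

(** Zorn's lemma on the ideals that contain [I] and are disjoint from [S]. *)
Lemma maximal_ideal_avoiding (A : comPzRingType) (I S : set A) :
  is_ideal I -> (forall s, S s -> ~ I s) ->
  exists P : set A,
    [/\ is_ideal P, (I `<=` P)%classic, forall s, S s -> ~ P s &
        forall J : set A, is_ideal J -> (P `<` J)%classic ->
          exists2 s, S s & J s].
Proof.
move=> idI SI; have [I0 _ _] := idI.
(* The empty set is admitted because it is the union of the empty chain. *)
pose good (J : set A) := J = set0 \/
  [/\ is_ideal J, (I `<=` J)%classic & forall s, S s -> ~ J s].
have goodE J z : good J -> J z ->
    [/\ is_ideal J, (I `<=` J)%classic & forall s, S s -> ~ J s].
  by case=> // ->.
have [F Fgood totF|P [[P0|[idP IP SP]] maxP]] := @Zorn_bigcup A good.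
- have [->|/set0P[z [J FJ Jz]]] := eqVneq (\bigcup_(X in F) X)%classic set0.
    by left.
  have [[J0 _ _] IJ _] := goodE J z (Fgood J FJ) Jz.
  right; split.
  + split; first by exists J.
    * move=> x y [X FX Xx] [Y FY Yy].
      have [[_ XD _] _ _] := goodE X x (Fgood X FX) Xx.
      have [[_ YD _] _ _] := goodE Y y (Fgood Y FY) Yy.
      case: (totF X Y FX FY) => [XY|YX].
        by exists Y => //; apply: YD => //; exact: XY.
      by exists X => //; apply: XD => //; exact: YX.
    * move=> a x [X FX Xx].
      have [[_ _ XM] _ _] := goodE X x (Fgood X FX) Xx.
      by exists X => //; exact: XM.
  + by move=> x Ix; exists J => //; exact: IJ.
  + move=> s Ss [X FX Xs].
    by have [_ _ XS] := goodE X s (Fgood X FX) Xs; apply: (XS s).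
(* A maximal element cannot be empty, since [I] itself is good and larger. *)
- have ltPI : (P `<` I)%classic by rewrite P0; split=> [z []|/(_ 0 I0) []].
  by case: (maxP I ltPI); apply: or_intror; split.
- exists P; split=> // J idJ PJ; apply: contrapT => nSJ.
  apply: (maxP J PJ); right; split=> //; first by move=> x /IP; apply: PJ.1.
  by move=> s Ss Js; apply: nSJ; exists s.
Qed.

(** If [x] and [y] lie outside a maximal such [P], then [P + <x>] and [P + <y>] meet [S] in some [s]
    and [t]. The product [s * t] is in [P + <x * y>], so [x * y] cannot be in [P]. *)
Lemma prime_ideal_avoiding (A : comPzRingType) (I S : set A) :
  is_ideal I -> mult_closed S -> (forall s, S s -> ~ I s) ->
  exists P : set A,
    [/\ prime_ideal P, (I `<=` P)%classic & forall s, S s -> ~ P s].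
Proof.
move=> idI [S1 SM] SI.
have [P [idP IP SP maxP]] := maximal_ideal_avoiding idI SI.
have [P0 PD PM] := idP.
exists P; split=> //; split=> //; first exact: SP.
have meet x : ~ P x -> exists2 s, S s & ideal_adjoin P x s.
  move=> nPx; apply: maxP; first exact: ideal_adjoin_ideal.
  split; first exact: sub_ideal_adjoin.
  by move=> /(_ x) sub; apply/nPx/sub/mem_ideal_adjoin.
move=> x y Pxy; apply: contrapT => /not_orP[/meet[s Ss [p [a [Pp se]]]]].
move=> /meet[t St [q [b [Pq te]]]].
apply: (SP (s * t)); first exact: SM.
rewrite (_ : s * t = t * p + a * x * q + a * b * (x * y)).
  by apply: (PD); [apply: (PD)|]; exact: PM.
by rewrite se te; ring.
Qed.

(** * Quotients of an integral ring of dimension less than 2 *)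

Lemma krull_dim_lt2_quotient (A : comPzRingType) (d x : A) :
  integral A -> krull_dim_lt A 2 -> d <> 0 ->
  exists (n : nat) (c q : A), x ^+ n * (1 - c * x) = q * d.
Proof.
move=> intA dimA d0; apply: contrapT => noeq.
have A1 : (1 : A) <> 0.
  by move=> A1; apply: d0; rewrite -(mul1r d) A1 mul0r.
pose S : set A := [set s | exists n c, s = x ^+ n * (1 - c * x)]%classic.
have multS : mult_closed S.
  split; first by exists 0%N, 0; rewrite expr0 mul0r subr0 mulr1.
  (* The witness comes from expanding [(1 - c * x) * (1 - e * x)]. *)
  move=> _ _ [n [c ->]] [m [e ->]]; exists (n + m)%N, (c + e - c * e * x).
  by rewrite exprD; ring.
have idd : is_ideal (ideal_adjoin [set (0 : A)]%classic d).
  exact/ideal_adjoin_ideal/zero_ideal.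
have [|P [prP dP SP]] := prime_ideal_avoiding idd multS.
  move=> _ [n [c ->]] [_ [q [-> E]]]; apply: noeq; exists n, c, q.
  by rewrite E add0r.
have [idP P1 _] := prP.
have nPx : ~ P x.
  by apply: SP; exists 1%N, 0; rewrite mul0r subr0 mulr1 expr1.
(* Avoiding [1] means being proper: if [1 = p + a * x] with [p] in [P], then [1 - a * x] is in both
   [P] and [S]. *)
have [|s s1|M [prM PM _]] := prime_ideal_avoiding (S := [set (1 : A)]%classic)
  (ideal_adjoin_ideal x idP).
- by split=> // s t -> ->; rewrite /= mulr1.
- rewrite s1 => -[p [a [Pp E]]]; apply: (SP (1 - a * x)).
    by exists 0%N, a; rewrite expr0 mul1r.
  by rewrite E addrK.
have pr0 : prime_ideal [set (0 : A)]%classic.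
  split; [exact: zero_ideal | exact: A1 | move=> y z /= yz].
  by have [|/(_ z yz)] := intA y; [left | right].
have lt0P : ([set (0 : A)] `<` P)%classic.
  split=> [_ ->|sub]; first by have [] := idP.
  by apply/d0/sub/dP/mem_ideal_adjoin/zero_ideal.
have ltPM : (P `<` M)%classic.
  split=> [y Py|sub]; first by apply/PM/sub_ideal_adjoin.
  by apply/nPx/sub/PM/mem_ideal_adjoin.
apply: dimA; exists (fun i => nth set0 [:: [set 0]; P; M] i)%classic.
split=> [[[|[|[|]]]] //|[[|[|[|]]] // ?] [[|[|[|]]] // ?] //= _].
by split=> [y /lt0P.1/ltPM.1 //|sub]; apply: ltPM.2 => y /sub/lt0P.1.
Qed.

(** * Jacobson triples of low order *)

Lemma ringquot_pi_eq0 (A : comPzRingType) (U : set A) (u : A) :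
  U u -> ringquot_pi U u = 0.
Proof.
move=> Uu; rewrite -(raddf0 (ringquot_pi U)).
by apply/ringquot_piP; rewrite subr0; exact: mem_ideal_gen.
Qed.

Lemma jacobson_triple0 (A : comPzRingType) (x x' : A) :
  nilradical x' -> jacobson_triple 0%N x x'.
Proof. exact: Jacobson0. Qed.

(** In each quotient [1 - c * x] has inverse [b], so the hypothesis leaves [x ^+ n = 0]. *)
Lemma jacobson_triple1 (A : comPzRingType) (x c : A) (n : nat) :
  x ^+ n * (1 - c * x) = 0 -> jacobson_triple 1%N x x.
Proof.
move=> xn; apply: JacobsonS => //; exists 1%N, (fun=> c) => b U.
exists 0%N => //; apply: jacobson_triple0; exists n.
have : ringquot_pi U (1 - b ord0 * (1 - c * x)) = 0.
  by apply: ringquot_pi_eq0; exists ord0.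
rewrite rmorphB => /eqP; rewrite subr_eq0 rmorph1 => /eqP E.
by rewrite -rmorphXn -[LHS]mulr1 E -rmorphM mulrCA xn mulr0 raddf0.
Qed.

(** The nilpotency clause applies only at the ordinal 0. The empty family [a] descends to it through
    the quotient by the zero ideal. *)
Lemma jacobson_triple2_nil (A : comPzRingType) (x : A) :
  nilradical x -> jacobson_triple 2%N x x.
Proof.
move=> [n xn]; apply: JacobsonS => //; exists 0%N, (fun=> 0) => b U.
exists 0%N => //; apply: jacobson_triple0; exists n.
by rewrite -rmorphXn xn raddf0.
Qed.

Lemma jacobson2_of_krull_dim_lt2 (A : comPzRingType) :
  integral A -> krull_dim_lt A 2 ->
  (forall x : A, regular x ->
     exists a : A, invertible (1 - a * x) -> 1 = 0 :> A) ->
  jacobson_ring 2%N A.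
Proof.
move=> intA dimA unitA x.
have [x0|/unitA[a nunit]] := intA x.
  by apply: jacobson_triple2_nil; exists 1%N; rewrite x0 expr1.
(* In the trivial ring [nunit] excludes nothing, but there [x ^+ 0 = 0]. *)
have [A1|/eqP A1] := eqVneq (1 : A) 0.
  by apply: jacobson_triple2_nil; exists 0%N; rewrite expr0.
apply: JacobsonS => //; exists 1%N, (fun=> a) => b U; exists 1%N => //.
have d0 : 1 - b ord0 * (1 - a * x) <> 0.
  move=> /eqP; rewrite subr_eq0 => /eqP E; apply/A1/nunit.
  by exists (b ord0); rewrite mulrC.
have [n [c [q E]]] := krull_dim_lt2_quotient x intA dimA d0.
apply: (@jacobson_triple1 _ _ (ringquot_pi U c) n).
rewrite -(rmorph1 (ringquot_pi U)) -rmorphXn -rmorphM -rmorphB -rmorphM E.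
rewrite (rmorphM _ q) [X in _ * X]ringquot_pi_eq0 ?mulr0 //.
by exists ord0.
Qed.

(** * Euclidean rings *)

Definition euclidean (A : comPzRingType) : Prop :=
  exists N : A -> nat, forall x y : A, y <> 0 ->
    exists q, x = q * y \/ (N (x - q * y)%R < N y)%N.

Lemma euclidean_principal (A : comPzRingType) (I : set A) :
  euclidean A -> is_ideal I ->
  exists2 g, I g & forall x, I x -> exists q, x = q * g.
Proof.
move=> [N div] [I0 ID IM].
have [[g0 Ig0 g00]|I_0] := pselect (exists2 g, I g & g <> 0); last first.
  exists 0 => // x Ix; exists 0; rewrite mul0r.
  by apply: contrapT => x0; apply: I_0; exists x.
have exN : exists n, `[< exists2 g, I g /\ g <> 0 & N g = n >].
  by exists (N g0); apply/asboolP; exists g0.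
case: (ex_minnP exN) => _ /asboolP[g [Ig gn0] <-] ming.
exists g => // x Ix; have [q [->|ltN]] := div x g gn0; first by exists q.
exists q; apply: contrapT => neq; move: ltN; rewrite ltnNge => /negP; apply.
apply: ming; apply/asboolP; exists (x - q * g) => //; split.
  by apply: ID => //; rewrite -mulNr; exact: IM.
by move=> /eqP; rewrite subr_eq0 => /eqP.
Qed.

(** In a chain [P0 < P1 < P2] write [P1 = <p>], [P2 = <q>] and [p = s * q]. As [P1] is prime, it
    contains [q], giving [P2 = P1], or [s], and then cancelling [p] makes [q] a unit. If [p = 0],
    then [P1] lies in [P0]. *)
Lemma euclidean_krull_dim_lt2 (A : comPzRingType) :
  integral A -> euclidean A -> krull_dim_lt A 2.
Proof.
move=> intA eA [P [prP ltP]].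
pose i1 : 'I_3 := Ordinal (isT : (1 < 3)%N).
have [_ n10] := ltP ord0 i1 isT; have [sub12 n21] := ltP i1 ord_max isT.
have [[id0 _ _] [id1 _ pr1] [id2 n1 _]] :=
  And3 (prP ord0) (prP i1) (prP ord_max).
have [p Pp genp] := euclidean_principal eA id1.
have [q Pq genq] := euclidean_principal eA id2.
have [s ps] := genq p (sub12 _ Pp).
have [p0|regp] := intA p.
  apply: n10 => x /genp[t ->]; rewrite p0 mulr0.
  by case: id0.
have [|Ps|P1q] := pr1 s q; first by rewrite -ps.
  have [t st] := genp s Ps; apply: n1.
  have [_ _ M2] := id2.
  suff -> : 1 = t * q by exact: M2.
  apply/eqP; rewrite -subr_eq0; apply/eqP/regp.
  by rewrite mulrBr mulr1 {1}ps st; ring.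
apply: n21 => x /genq[t ->].
by have [_ _ M1] := id1; exact: M1.
Qed.

(** * The integers *)

Lemma int_euclidean : euclidean int.
Proof.
exists absz => x y /eqP y0; exists (x %/ y)%Z; right.
rewrite {1}(divz_eq x y) addrC addKr -ltz_nat gez0_abs ?modz_ge0 //.
by rewrite abszE ltz_mod.
Qed.

Lemma int_jacobson : jacobson_ring 2%N int.
Proof.
have intZ : integral int.
  move=> x; have [->|x0] := eqVneq x 0; [by left | right=> y /eqP].
  by rewrite mulf_eq0 (negPf x0) => /eqP.
apply: jacobson2_of_krull_dim_lt2 => //.
  exact/euclidean_krull_dim_lt2/int_euclidean.
(* For nonzero [x], [1 - 3 * x] is never 1 or -1, whereas [1 - 2 * x] is -1 at [x = 1]. *)
move=> x regx; exists 3 => -[y xy].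
have x0 : x <> 0 by move=> x0; have := regx 1; rewrite x0 mul0r => /(_ erefl).
exfalso.
have : (1 - 3 * x %| 1)%Z by apply/dvdzP; exists y; rewrite mulrC; exact: esym xy.
rewrite dvdz1; lia.
Qed.

(** * Polynomials over a discrete field *)

(** An equality of ring structures, rather than an isomorphism, lets results on [pzpoly F] be
    rewritten into results on [pzpoly K]. *)
Lemma discrete_field_fieldType (K : comPzRingType) :
  discrete_field K -> (1 : K) <> 0 ->
  exists F : fieldType, F = K :> comPzRingType.
Proof.
move=> fK /eqP K1.
have exinv (x : K) : exists y : K, (x != 0 -> y * x = 1) /\ (x = 0 -> y = 0).
  have [->|[y xy]] := fK x; first by exists 0; rewrite eqxx.
  exists y; split=> [_|x0]; first by rewrite mulrC.
  by move: K1; rewrite -xy x0 mul0r eqxx.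
have [inv invP] := choice exinv.
pose nz := GRing.PzSemiRing_isNonZero.Build K K1.
pose N : comNzRingType := HB.pack (GRing.ComPzRing.sort K) K nz.
have mulVf (x : N) : x != 0 -> (inv x : N) * x = 1 by case: (invP x).
have inv0 : inv (0 : N) = 0 :> N by case: (invP 0) => _; apply.
pose fm := GRing.ComNzRing_isField.Build N mulVf inv0.
pose F : fieldType := HB.pack (GRing.ComNzRing.sort N) N fm.
exists F.
(* Records have no definitional eta. *)
have eta (R : comPzRingType) :
  R = GRing.ComPzRing.Pack (GRing.ComPzRing.class R) by case: R.
by rewrite [RHS]eta [LHS]eta.
Qed.

(** Division and degree are transported from [{poly F}] along the isomorphism [f] with inverse
    [g]. *)
Lemma pzpoly_jacobson (F : fieldType) : jacobson_ring 2%N (pzpoly F).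
Proof.
pose f : {poly F} -> pzpoly F := @pzpoly_of_poly F.
have [g fK gK] := pzpoly_of_poly_bij F.
have g0 x : x <> 0 -> g x != 0.
  by move=> x0; apply/eqP => gx; apply: x0; rewrite -(gK x) gx raddf0.
have intP : integral (pzpoly F).
  move=> x; have [|/g0 x0] := pselect (x = 0); [by left | right=> y].
  rewrite -{1}(gK x) -{1}(gK y) -rmorphM => /(congr1 g); rewrite fK.
  rewrite -(raddf0 (@pzpoly_of_poly F)) fK => /eqP.
  by rewrite mulf_eq0 (negPf x0) => /eqP gy; rewrite -(gK y) gy.
apply: jacobson2_of_krull_dim_lt2 => //.
  apply: euclidean_krull_dim_lt2 => //; exists (fun p => size (g p)).
  move=> x y /g0 y0; exists (f (g x %/ g y)); right.
  rewrite -{1}(gK x) -{2}(gK y) -rmorphM -rmorphB fK.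
  by rewrite {1}(divp_eq (g x) (g y)) addrC addKr ltn_modp.
move=> x regx; exists (f 'X) => -[y xy]; exfalso.
have x0 : x <> 0.
  move=> x0; have := regx 1; rewrite x0 mul0r.
  move=> /(_ erefl)/(congr1 g).
  rewrite -(rmorph1 (@pzpoly_of_poly F)) -(raddf0 (@pzpoly_of_poly F)) !fK.
  by apply/eqP; rewrite oner_eq0.
have : (1 - 'X * g x) * g y = 1.
  apply: (can_inj fK); rewrite !(rmorphM, rmorphB, rmorph1) /= !gK.
  exact: xy.
move=> E; have : (1 - 'X * g x) \is a GRing.unit.
  by apply/unitrP; exists (g y); split; rewrite // mulrC.
(* A unit has size 1, but [1 - 'X * g x] has size one more than that of the nonzero [g x]. *)
rewrite poly_unitE => /andP[/eqP + _].
rewrite addrC size_polyDl size_polyN mulrC size_mulX ?g0 // ?size_poly1.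
  by move=> [] /eqP; rewrite size_poly_eq0; apply/negP/g0.
by rewrite ltnS lt0n size_poly_eq0 g0.
Qed.

Theorem proposition7 :
  (forall A : comPzRingType,
     integral A ->
     krull_dim_lt A 2 ->
     (forall x : A, regular x ->
        exists a : A, invertible (1 - a * x) -> 1 = 0 :> A) ->
     jacobson_ring 2%N A) /\
  jacobson_ring 2%N int /\
  (forall K : comPzRingType, discrete_field K -> jacobson_ring 2%N (pzpoly K)).
Proof.
split; first exact: jacobson2_of_krull_dim_lt2.
split=> [|K fK]; first exact: int_jacobson.
have [K1|K1] := pselect ((1 : K) = 0); last first.
  by have [F <-] := discrete_field_fieldType fK K1; exact: pzpoly_jacobson.
(* The trivial ring is a discrete field too, and over it every polynomial is zero. *)
move=> x; apply: jacobson_triple2_nil; exists 1%N; apply: pzpolyP => i.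
by rewrite -[LHS]mulr1 K1 mulr0.
Qed.
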